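(* For any integer $n\ge 1$ and any integer $0\le r\le n-1$, $$\mathbb E M_{n,r}\ge\sup_{0<\varepsilon\le1/2}\left\{\varphi^{-}_{n,r}(\varepsilon)+\theta^{-}_{n,r}(\varepsilon)\right\},$$ where $$\varphi^{-}_{n,r}(\varepsilon)=\binom{n}{r}\nu(\varepsilon)\,\varepsilon^{r+1}(1-p_\star)^{n-r},$$ $$\theta^{-}_{n,r}(\varepsilon)=2^{-r}\binom{n}{r}\int_{0}^{\varepsilon}(1-\kappa_-(2u))\,\nu(u)\,u^{r}\left(1-2u\right)^{n-r}\mathrm du,$$ and $p_\star=\max\{p_a:a\in\mathcal A\}$.
   Context: $\mathcal A$ is an at most countable set and $P=\{p_a:a\in\mathcal A\}$ is a probability distribution on $\mathcal A$ ($p_a\in[0,1]$, $\sum_{a}p_a=1$). $X_1,\dots,X_n$ are i.i.d. $\mathcal A$-valued random variables with distribution $P$; $\xi_n(a)=\sum_{i=1}^n\mathbf 1\{X_i=a\}$. For $0\le r\le n$, $M_{n,r}=\sum_{a\in\mathcal A}p_a\mathbf 1\{\xi_n(a)=r\}$. The counting function of $P$ is $\nu(\varepsilon)=|\{a\in\mathcal A:p_a\ge\varepsilon\}|$ for $0\le\varepsilon\le 1$. For $\varepsilon\in(0,1]$, $\kappa_-(\varepsilon)=\sup_{0<u\le\varepsilon}\nu(u)/\nu(u/2)\in[0,1]$, where the ratio $0/0$ is interpreted as $0$. *)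

(* Defs.v *)
From HB Require Import structures.
From mathcomp Require Import all_boot all_order all_algebra.
From mathcomp Require Import all_classical all_reals all_analysis.

Set Implicit Arguments.
Unset Strict Implicit.
Unset Printing Implicit Defensive.

Import Order.TTheory GRing.Theory Num.Theory.
Import numFieldNormedType.Exports.

Local Open Scope classical_set_scope.
Local Open Scope ring_scope.

Section distribution.
Context (R : realType) (A : choiceType).
Implicit Types (p : A -> R) (eps u : R) (n r : nat).

Definition is_distribution p : Prop :=
  (forall a, 0 <= p a <= 1) /\ \esum_(a in [set: A]) (p a)%:E = 1%E.

(* Finite for eps > 0; nu p 0 = |A| is +oo when A is infinite. *)
Definition nu p eps : \bar R := counting [set a | eps <= p a].

(* MathComp has x / 0 = 0, hence the convention 0 / 0 = 0. *)
Definition nu_ratio p u : R := fine (nu p u) / fine (nu p (u / 2)).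

Definition kappa_minus p eps : R := sup [set nu_ratio p u | u in `]0, eps]].

(* When p is a distribution on a countable set, this supremum is attained. *)
Definition p_star p : R := sup (range p).

Definition phi_minus p n r eps : \bar R :=
  ('C(n, r)%:R%:E * nu p eps * (eps ^+ r.+1 * (1 - p_star p) ^+ (n - r))%:E)%E.

Definition theta_minus p n r eps : \bar R :=
  ((2 ^- r * 'C(n, r)%:R)%:E *
   \int[lebesgue_measure]_(u in `]0%R, eps])
     ((1 - kappa_minus p (2 * u))%:E * nu p u *
      (u ^+ r * (1 - 2 * u) ^+ (n - r))%:E))%E.

End distribution.

Section sample.
Context (R : realType) (dO dA : measure_display) (Omega : measurableType dO)
  (A : measurableType dA) (Pr : probability Omega R) (n : nat).
Implicit Type X : 'I_n -> {RV Pr >-> A}.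

Definition independent_RVs X : Prop :=
  forall (J : {set 'I_n}) (B : 'I_n -> set A),
    (forall i, measurable (B i)) ->
    Pr (\bigcap_(i in [set` J]) (X i @^-1` B i)) =
    (\prod_(i in J) Pr (X i @^-1` B i))%E.

(* On a countable A with measurable singletons, the values on singletons
   determine the law. *)
Definition iid_sample (p : A -> R) X : Prop :=
  independent_RVs X /\
  forall i a, distribution Pr (X i) [set a] = (p a)%:E.

Definition xi X (a : A) (w : Omega) : nat := \sum_(i < n) (X i w == a).

(* The sum is at most 1, so [fine] loses nothing. *)
Definition occupancy_mass (p : A -> R) X (r : nat) (w : Omega) : R :=
  fine (\esum_(a in [set: A]) (p a * (xi X a w == r)%:R)%:E).

End sample.

(* Main.v *)
Require Import Defs.
From mathcomp Require Import all_boot all_order all_algebra.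
From mathcomp Require Import finmap ring lra.
From mathcomp Require Import all_classical all_reals all_analysis.
From mathcomp Require Import measurable_realfun.

Set Implicit Arguments.
Unset Strict Implicit.
Unset Printing Implicit Defensive.

Import Order.TTheory GRing.Theory Num.Theory.
Import numFieldNormedType.Exports.

Local Open Scope classical_set_scope.
Local Open Scope ring_scope.

(** Write [w(x) = C(n,r) x^(r+1) (1-x)^(n-r)].  Each count [xi_n(a)] is
    binomial with parameters [n] and [p_a], so Tonelli over the countable
    alphabet gives [E M_(n,r) = sum_a w(p_a)]
    ([expectation_occupancy_mass]).  Fix [eps] and split this sum at
    [p_a >= eps].

    The heavy letters pay for phi: each of them has
    [w(p_a) >= C(n,r) eps^(r+1) (1-p_star)^(n-r)], and there are [nu(eps)] of
    them ([phi_minus_le]).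

    The light letters pay for theta ([theta_minus_le]).  The ratio
    [nu(u)/nu(u/2)] is one of those over which [kappa(2u)] is the supremum,
    hence
    [(1 - kappa(2u)) nu(u) <= (1 - nu(u)/nu(u/2)) nu(u/2)
                            = #{a : u/2 <= p_a < u}]
    ([kappa_nu_le]).  For [u <= eps] only letters with [p_a < eps] are counted
    here, so heavy letters are not used twice.  A letter of mass [p] is
    counted exactly for [u] in [(p, 2p]], an interval of length [p], on which
    [u^r (1-2u)^(n-r) <= (2p)^r (1-p)^(n-r)].  After exchanging sum and
    integral it therefore contributes at most [2^r p^(r+1) (1-p)^(n-r)], and
    the prefactor [2^(-r) C(n,r)] turns this into [w(p)]. *)

(** * Sums over countable sets and their integrals *)

Lemma esumZl (R : realType) (A : choiceType) (S : set A) (k : R)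
    (f : A -> \bar R) :
  0 <= k -> (forall a, (0 <= f a)%E) ->
  (\esum_(a in S) (k%:E * f a) = k%:E * \esum_(a in S) f a)%E.
Proof.
move=> k0 f0; rewrite /esum -ereal_supZl//; last first.
  apply/set0P; exists 0%E; exists set0; first exact: fsets_set0.
  by rewrite fsbig_set0.
congr ereal_sup; apply/seteqP; split => [_ [F FS <-]|_ [_ [F FS <-] <-]].
  by exists (\sum_(x \in F) f x)%E; [exists F|rewrite ge0_mule_fsumr].
by exists F => //; rewrite ge0_mule_fsumr.
Qed.

(** Transports sums over a countable type to series, for which termwise
    integration is known.  The enumeration [g] skips indices through [None],
    which covers empty, finite and infinite types alike, and it does not depend
    on [f], so that one enumeration serves every point of the integration
    domain. *)
Lemma esum_enum (A : choiceType) : countable [set: A] ->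
  exists g : nat -> option A, forall (R : realType) (f : A -> \bar R),
    (forall a, (0 <= f a)%E) ->
    (\esum_(a in [set: A]) f a = \sum_(i <oo) oapp f 0 (g i))%E.
Proof.
move=> /countable_injP[e einj].
pose g i :=
  if pselect (exists a, e a = i) is left ex then Some (projT1 (cid ex)) else None.
have ge a : g (e a) = Some a.
  rewrite /g; case: pselect => [ex|[]]; last by exists a.
  by congr Some; apply: einj; rewrite ?inE//; case: (cid ex).
exists g => R f f0.
rewrite nneseries_esumT; last by move=> i; case: (g i) => /=.
transitivity (\esum_(i in range e) oapp f 0 (g i))%E.
  rewrite esum_image//; by apply: eq_esum => a _; rewrite ge.
rewrite esum_mkcond; apply: eq_esum => i _; case: ifPn => // /negP nei.
rewrite /g; case: pselect => //= -[a eai].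
by exfalso; apply: nei; rewrite inE; exists a.
Qed.

Lemma integral_esum (R : realType) (d : measure_display)
    (T : measurableType d) (mu : {measure set T -> \bar R}) (A : choiceType)
    (D : set T) (f : A -> T -> \bar R) :
  countable [set: A] -> measurable D ->
  (forall a, measurable_fun D (f a)) -> (forall a x, (0 <= f a x)%E) ->
  (\int[mu]_(x in D) (\esum_(a in [set: A]) f a x) =
   \esum_(a in [set: A]) \int[mu]_(x in D) f a x)%E.
Proof.
move=> /esum_enum[g gE] mD mf f0.
under eq_integral do rewrite (gE _ (f^~ _))//.
rewrite gE; last by move=> a; exact: integral_ge0.
rewrite integral_nneseries//.
- apply: eq_eseriesr => i _; case: (g i) => [a|] //=.
  by rewrite integral0.
- by move=> i; case: (g i) => [a|] /=; [exact: mf|exact: measurable_cst].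
- by move=> i x _; case: (g i) => /=.
Qed.

(** The integral of a nonnegative function is a supremum over the simple
    functions below it, and this supremum is monotone whether or not the
    functions are measurable.  This saves proving that [kappa] and [nu] are
    measurable functions of the threshold. *)
Lemma ge0_le_integral_nomeas (R : realType) (d : measure_display)
    (T : measurableType d) (mu : {measure set T -> \bar R})
    (D : set T) (f g : T -> \bar R) :
  (forall x, D x -> (0 <= f x)%E) -> (forall x, D x -> (f x <= g x)%E) ->
  (\int[mu]_(x in D) f x <= \int[mu]_(x in D) g x)%E.
Proof.
move=> f0 fg; rewrite !ge0_integralE//; last first.
  by move=> x Dx; exact: le_trans (f0 x Dx) (fg x Dx).
apply: ge_ereal_sup => /= _ [h hf <-].
apply: ereal_sup_ubound; exists h => //= x.
apply: le_trans (hf x) _; rewrite /patch; case: ifPn => // /[!inE].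
exact: fg.
Qed.

Lemma countingE_esum (R : realType) (A : choiceType) (S : set A) :
  finite_set S -> counting S = \esum_(a in S) 1%E :> \bar R.
Proof.
move=> fS; rewrite esum_fset// fsbig_finite//= /counting asboolT//.
by rewrite (sumEFin _ _ (fun=> 1)) big_const_seq count_predT iter_addr_0.
Qed.

(** * The counting function and its dyadic ratio *)

Section counting_function.
Context (R : realType) (A : choiceType) (p : A -> R).
Hypothesis pP : is_distribution p.

Lemma distr_ge0 a : 0 <= p a. Proof. by case/andP: (pP.1 a). Qed.
Lemma distr_le1 a : p a <= 1. Proof. by case/andP: (pP.1 a). Qed.

(** More than [1 / u] letters of mass at least [u] would exceed total mass 1. *)
Lemma finite_superlevel (u : R) : 0 < u -> finite_set [set a | u <= p a].
Proof.
move=> u0; apply: contrapT.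
move=> /(infinite_set_fset (Num.truncn u^-1).+1)[B BS Bn].
suff : (1 < \esum_(a in [set: A]) (p a)%:E)%E by rewrite pP.2 ltxx.
apply: (@lt_le_trans _ _ (u *+ #|` B|)%:E).
  rewrite lte_fin -mulr_natr -ltr_pdivrMl// mulr1.
  by apply: lt_le_trans (Num.Theory.truncnS_gt _) _; rewrite ler_nat.
apply: esum_ge; exists [set` B]; first by split.
rewrite -fsbig_seq//= sumEFin lee_fin.
rewrite -[X in X <= _](_ : \sum_(i <- B) u = _).
  by rewrite big_seq [X in _ <= X]big_seq; apply: ler_sum => a /BS.
by rewrite big_const_seq count_predT iter_addr_0.
Qed.

Lemma nu_esum (u : R) : 0 < u ->
  nu p u = (\esum_(a in [set a | (u <= p a)%R]) 1)%E.
Proof. by move=> u0; exact/countingE_esum/finite_superlevel. Qed.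

Lemma nu_fin (u : R) : 0 < u -> nu p u = (fine (nu p u))%:E.
Proof.
by move=> u0; rewrite /nu /counting asboolT//; exact: finite_superlevel.
Qed.

Lemma fine_nu_ge0 u : 0 <= fine (nu p u).
Proof. by rewrite /nu /counting; case: ifP => //=. Qed.

Lemma nu_half (u : R) : 0 < u ->
  nu p (u / 2) = (nu p u + \esum_(a in [set a | (u / 2 <= p a < u)%R]) 1)%E.
Proof.
move=> u0; rewrite !nu_esum ?divr_gt0//.
rewrite (esumID [set a | u <= p a])//; congr (_ + _)%E.
- congr esum; apply/seteqP; split => a /=; first by case.
  move=> ua; split => //; apply: le_trans ua.
  by lra.
- congr esum; apply/seteqP; split => a /=.
    by move=> [-> /negP]; rewrite -ltNge.
  by move=> /andP[-> au]; split => //; apply/negP; rewrite -ltNge.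
Qed.

Lemma fine_nu_half (u : R) : 0 < u -> fine (nu p u) <= fine (nu p (u / 2)).
Proof.
move=> u0; rewrite -lee_fin -!nu_fin ?divr_gt0// nu_half// leeDl//.
by apply: esum_ge0.
Qed.

Lemma nu_ratio_le1 (u : R) : 0 < u -> nu_ratio p u <= 1.
Proof.
move=> u0; rewrite /nu_ratio; have := fine_nu_half u0.
have := fine_nu_ge0 (u / 2); rewrite le_eqVlt => /predU1P[<-|v0 le].
  by rewrite invr0 mulr0.
by rewrite ler_pdivrMr// mul1r.
Qed.

Lemma nu_ratio_le_kappa (u eps : R) : 0 < u <= eps ->
  nu_ratio p u <= kappa_minus p eps.
Proof.
move=> ue; apply: ub_le_sup; last by exists u => //=; rewrite in_itv.
by exists 1 => _ [v /= /[!in_itv]/= /andP[v0 _] <-]; exact: nu_ratio_le1.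
Qed.

Lemma kappa_le1 (eps : R) : 0 < eps -> kappa_minus p eps <= 1.
Proof.
move=> e0; apply: ge_sup.
  by exists (nu_ratio p eps), eps => //=; rewrite in_itv/= e0 lexx.
by move=> _ [v /= /[!in_itv]/= /andP[v0 _] <-]; exact: nu_ratio_le1.
Qed.

(** With [m = nu u] and [m' = nu (u / 2)], the bounds [m / m' <= kappa(2u)]
    and [m <= m'] give [(1 - kappa(2u)) m <= (1 - m / m') m' = m' - m].  Passing
    from [u] to [u / 2] rather than to [2 * u] matters: it keeps the counted
    masses below [u]. *)
Lemma kappa_nu_le (u : R) : 0 < u ->
  ((1 - kappa_minus p (2 * u))%:E * nu p u <=
   \esum_(a in [set a | (u / 2 <= p a < u)%R]) 1)%E.
Proof.
move=> u0; have h2 : 0 < u / 2 by rewrite divr_gt0.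
have := nu_half u0.
rewrite (nu_fin u0) (nu_fin h2) -EFinM => /eqP.
rewrite addeC -sube_eq//; last by rewrite fin_num_adde_defl.
move=> /eqP <-; rewrite -EFinB lee_fin.
have ku : nu_ratio p u <= kappa_minus p (2 * u).
  by apply: nu_ratio_le_kappa; rewrite u0 ler_peMl ?ltW ?ltr1n.
have := fine_nu_half u0; move: ku; rewrite /nu_ratio.
move: (fine_nu_ge0 u) (fine_nu_ge0 (u/2)).
set m := fine (nu p u); set m' := fine (nu p (u / 2)).
move=> m0; rewrite le_eqVlt => /predU1P[<- _ m00|m'0 mk mm'].
  (* No letter has mass u / 2 or more, and both sides vanish. *)
  by have -> : m = 0 by [apply/eqP; rewrite eq_le m00]; rewrite mulr0 subr0.
apply: (@le_trans _ _ ((1 - m / m') * m)).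
  by rewrite ler_wpM2r// lerB.
have : (1 - m / m') * m <= (1 - m / m') * m'.
  by rewrite ler_wpM2l// subr_ge0 ler_pdivrMr ?mul1r.
by rewrite [X in _ <= X -> _]mulrBl mul1r divfK ?gt_eqF.
Qed.

End counting_function.

(** * Heavy and light letters *)

(** The share of one letter of mass [x] in the expected occupancy mass. *)
Definition binom_mass (R : realType) (n r : nat) (x : R) : R :=
  'C(n, r)%:R * (x ^+ r.+1 * (1 - x) ^+ (n - r)).

Section lower_bounds.
Context (R : realType) (A : choiceType) (p : A -> R).
Hypothesis pP : is_distribution p.
Implicit Types (n r : nat) (eps : R).

Lemma binom_mass_ge0 n r (x : R) : 0 <= x <= 1 -> 0 <= binom_mass n r x.
Proof.
by move=> /andP[x0 x1]; rewrite !mulr_ge0// exprn_ge0// subr_ge0.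
Qed.

Lemma p_le_star a : p a <= p_star p.
Proof.
apply: ub_le_sup; last by exists a.
by exists 1 => _ [b _ <-]; exact: distr_le1.
Qed.

Lemma phi_minus_le n r eps : 0 < eps ->
  (phi_minus p n r eps <=
   \esum_(a in [set a | (eps <= p a)%R]) (binom_mass n r (p a))%:E)%E.
Proof.
move=> e0; rewrite /phi_minus muleAC nu_esum// -EFinM.
have [->|/set0P[a0 _]] := eqVneq [set a | eps <= p a] set0.
  by rewrite !esum_set0 mule0.
have q0 : 0 <= 1 - p_star p.
  rewrite subr_ge0; apply: ge_sup; first by exists (p a0), a0.
  by move=> _ [b _ <-]; exact: distr_le1.
rewrite -esumZl//; last by rewrite !mulr_ge0// exprn_ge0// ltW.
apply: le_esum => a /= ea; rewrite mule1 lee_fin ler_wpM2l//.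
apply: ler_pM; rewrite ?exprn_ge0// ?(ltW e0)//.
  by rewrite lerXn2r// nnegrE ltW// (lt_le_trans e0).
rewrite lerXn2r// ?nnegrE ?subr_ge0 ?distr_le1// lerB//.
exact: p_le_star.
Qed.

Lemma theta_minus_le n r eps : countable [set: A] -> 0 < eps <= 1 / 2 ->
  (theta_minus p n r eps <=
   \esum_(a in [set a | (p a < eps)%R]) (binom_mass n r (p a))%:E)%E.
Proof.
move=> cA /andP[e0 e1].
(* [c a] bounds [u^r (1-2u)^(n-r)] on the interval where letter [a] counts. *)
pose c a := if p a < eps then 2 ^+ r * p a ^+ r * (1 - p a) ^+ (n - r) else 0.
have c0 a : 0 <= c a.
  rewrite /c; case: ifP => // _; have pa0 := distr_ge0 pP a.
  have pa1 := distr_le1 pP a.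
  by rewrite !mulr_ge0 ?exprn_ge0 ?subr_ge0.
pose F a u := ((c a)%:E * (\1_(`]p a, (2 * p a)]) u)%:E)%E.
have F0 a u : (0 <= F a u)%E by rewrite mule_ge0// lee_fin.
have mF a : measurable_fun `]0, eps] (F a).
  apply: measurable_funeM; apply/measurable_EFinP; exact: measurable_indic.
have intF a :
  (\int[lebesgue_measure]_(u in `]0%R, eps]) F a u <= (c a * p a)%:E)%E.
  rewrite ge0_integralZl_EFin//; last first.
    by apply/measurable_EFinP; exact: measurable_indic.
  rewrite integral_indic// EFinM lee_wpmul2l ?lee_fin//.
  apply: (@le_trans _ _ (lebesgue_measure `]p a, (2 * p a)])).
    by apply: le_measure; rewrite ?inE//; exact: measurableI.
  have pa0 := distr_ge0 pP a.
  rewrite lebesgue_measure_itv/=; case: ifP => _; rewrite ?lee_fin//.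
  by lra.
have step u : u \in `]0, eps] ->
  ((1 - kappa_minus p (2 * u))%:E * nu p u *
   (u ^+ r * (1 - 2 * u) ^+ (n - r))%:E
   <= \esum_(a in [set: A]) F a u)%E.
  rewrite in_itv/= => /andP[u0 ue].
  have h0 : 0 <= u ^+ r * (1 - 2 * u) ^+ (n - r).
    by rewrite mulr_ge0// exprn_ge0 ?(ltW u0)//; lra.
  apply: le_trans (lee_wpmul2r _ (kappa_nu_le pP u0)) _.
    by rewrite lee_fin.
  rewrite muleC -esumZl// esum_mkcond; apply: le_esum => a _.
  case: ifPn => // /[!inE]/= /andP[pa1 pa2].
  have pa0 := distr_ge0 pP a.
  rewrite /F /c (lt_le_trans pa2 ue) mule1 indicE mem_set /=; last first.
    by rewrite in_itv/= pa2; lra.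
  rewrite mule1 lee_fin ler_pM ?exprn_ge0//; [lra|lra| |].
    by rewrite -exprMn lerXn2r// ?nnegrE; lra.
  by rewrite lerXn2r// ?nnegrE; lra.
rewrite /theta_minus.
have k0 : 0 <= 2 ^- r * 'C(n, r)%:R :> R.
  by rewrite mulr_ge0// invr_ge0 exprn_ge0.
have i0 u : u \in `]0, eps] -> (0 <= (1 - kappa_minus p (2 * u))%:E * nu p u *
    (u ^+ r * (1 - 2 * u) ^+ (n - r))%:E)%E.
  rewrite in_itv/= => /andP[u0 ue].
  rewrite !mule_ge0 ?lee_fin//.
  - by rewrite subr_ge0 kappa_le1// mulr_gt0.
  - by rewrite nu_esum// esum_ge0.
  - by rewrite mulr_ge0// exprn_ge0 ?(ltW u0)//; lra.
have le1 : (\int[lebesgue_measure]_(u in `]0%R, eps])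
     ((1 - kappa_minus p (2 * u))%:E * nu p u *
      (u ^+ r * (1 - 2 * u) ^+ (n - r))%:E) <=
     \esum_(a in [set: A]) (c a * p a)%:E)%E.
  apply: le_trans.
    by apply: ge0_le_integral_nomeas => u; [exact: i0|exact: step].
  by rewrite integral_esum//; apply: le_esum => a _; exact: intF.
apply: (@le_trans _ _ ((2 ^- r * 'C(n, r)%:R)%:E *
    \esum_(a in [set: A]) (c a * p a)%:E)%E).
  by rewrite lee_wpmul2l ?lee_fin.
rewrite -esumZl//; last first.
  by move=> a; rewrite lee_fin; apply: mulr_ge0; rewrite ?(distr_ge0 pP).
rewrite [X in (_ <= X)%E]esum_mkcond; apply: le_esum => a _.
rewrite -EFinM /c; case: ifPn => [pae|pae].
  rewrite mem_set// lee_fin /binom_mass exprS.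
  rewrite [X in _ <= X](_ : _ = 2 ^- r * 'C(n, r)%:R *
     (2 ^+ r * p a ^+ r * (1 - p a) ^+ (n - r) * p a))//.
  have : (2 ^+ r : R) != 0 by rewrite expf_neq0.
  move: (2 ^+ r) => z z0; by field.
rewrite mul0r mulr0 memNset//=; exact/negP.
Qed.

End lower_bounds.

(** * The expected occupancy mass *)

Section occupancy.
Context (R : realType) (dO dA : measure_display)
  (Omega : measurableType dO) (Pr : probability Omega R)
  (A : measurableType dA) (p : A -> R) (n : nat)
  (X : 'I_n -> {RV Pr >-> A}).
Hypothesis mA : forall a : A, measurable [set a].
Hypothesis iidX : iid_sample p X.

Definition hits (a : A) (w : Omega) : {set 'I_n} := [set i | X i w == a]%SET.

Lemma xi_hits a w : xi X a w = #|hits a w|.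
Proof.
rewrite /xi -sum1_card [RHS]big_mkcond/=.
by apply: eq_bigr => i _; rewrite inE; case: eqP.
Qed.

(** Prescribing which draws hit [a] is a product event, to which independence
    applies. *)
Lemma hitsE a (J : {set 'I_n}) : [set w | hits a w = J] =
  \bigcap_(i in [set` [set: 'I_n]%SET])
    (X i @^-1` (if i \in J then [set a] else ~` [set a])).
Proof.
apply/seteqP; split => [w /= <- i _ |w /= h].
  by rewrite /= inE; case: eqP.
apply/setP => i; rewrite inE.
have /= := h i; rewrite inE => /(_ isT).
by case: (i \in J) => /= [|nX]; [move=> ->; rewrite eqxx|apply/negbTE/eqP].
Qed.

Lemma measurable_hits a J : measurable [set w | hits a w = J].
Proof.
rewrite hitsE; apply: fin_bigcap_measurable => // i _.
apply: measurable_funPTI => //.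
by case: ifP => _ //; exact: measurableC.
Qed.

Lemma Pr_hits a J :
  Pr [set w | hits a w = J] = (p a ^+ #|J| * (1 - p a) ^+ (n - #|J|))%:E.
Proof.
rewrite hitsE iidX.1; last by move=> i; case: ifP => _ //; exact: measurableC.
have PrX i : Pr (X i @^-1` [set a]) = (p a)%:E by rewrite -(iidX.2 i a).
have PrXC i : Pr (X i @^-1` (~` [set a])) = (1 - p a)%:E.
  rewrite -preimage_setC probability_setC ?PrX//.
  exact: measurable_funPTI.
rewrite (eq_bigr (fun i => (if i \in J then p a else 1 - p a)%:E)); last first.
  by move=> i _; case: ifP.
rewrite prodEFin; congr EFin.
rewrite (eq_bigl xpredT); last by move=> i; rewrite inE.
rewrite (bigID (mem J))/=; congr (_ * _).
  by rewrite (eq_bigr (fun=> p a)) ?prodr_const// => i ->.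
rewrite (eq_bigr (fun=> 1 - p a)); last by move=> i /negbTE ->.
rewrite prodr_const; congr (_ ^+ _).
rewrite -[X in (X - _)%N](card_ord n) -(cardC (mem J)) addKn.
by apply: eq_card => i; rewrite !inE.
Qed.

Lemma xi_eqE a r : [set w | xi X a w = r] =
  \bigcup_(J in [set J : {set 'I_n} | #|J| = r]) [set w | hits a w = J].
Proof.
apply/seteqP; split => [w /= <-|w [J /= <- <-]]; last by rewrite xi_hits.
by exists (hits a w) => //=; rewrite xi_hits.
Qed.

Lemma measurable_xi_eq a r : measurable [set w | xi X a w = r].
Proof.
rewrite xi_eqE; apply: fin_bigcup_measurable => // J _.
exact: measurable_hits.
Qed.

(** The binomial law: [xi] equals [r] in [C(n,r)] disjoint ways, one for each
    set of [r] draws that hit [a], all of the same probability. *)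
Lemma Pr_xi_eq a r : Pr [set w | xi X a w = r] =
  ('C(n, r)%:R * (p a ^+ r * (1 - p a) ^+ (n - r)))%:E.
Proof.
rewrite xi_eqE measure_fin_bigcup; last 3 first.
- exact: finite_finset.
- by move=> J K _ _ [w [/= <- <-]].
- by move=> J _; exact: measurable_hits.
rewrite (eq_fsbigr (fun=> (p a ^+ r * (1 - p a) ^+ (n - r))%:E)); last first.
  by move=> J /[!inE]/= <-; rewrite Pr_hits.
rewrite fsbig_finite; last exact: finite_finset.
rewrite sumEFin big_const_seq count_predT iter_addr_0.
congr EFin; rewrite -[LHS]mulr_natl; congr (_%:R * _).
rewrite -[in RHS](card_ord n) -card_draws cardE.
apply/perm_size/uniq_perm => [||J]; rewrite ?enum_uniq ?fset_uniq//.
rewrite in_fset_set; last exact: finite_finset.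
rewrite mem_enum !inE.
by apply/idP/eqP => [/set_mem|/mem_set].
Qed.

Lemma expectation_occupancy_mass r :
  countable [set: A] -> is_distribution p ->
  ('E_Pr[occupancy_mass p X r] =
   \esum_(a in [set: A]) (binom_mass n r (p a))%:E)%E.
Proof.
move=> cA pP; rewrite unlock.
have p0 a := distr_ge0 pP a.
have t0 a w : (0 <= (p a * (xi X a w == r)%:R)%:E)%E.
  by rewrite lee_fin mulr_ge0.
(* The mass is at most 1, so the projection from extended reals loses
   nothing. *)
have fin_mass w : (\esum_(a in [set: A]) (p a * (xi X a w == r)%:R)%:E)%E
    \is a fin_num.
  rewrite ge0_fin_numE; last exact: esum_ge0.
  apply: (@le_lt_trans _ _ 1%E); last exact: ltry.
  rewrite -pP.2; apply: le_esum => a _; rewrite lee_fin.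
  by case: (_ == _); rewrite ?mulr1// mulr0.
have ind a w : (p a * (xi X a w == r)%:R)%:E =
    ((p a)%:E * (\1_([set w | xi X a w = r]) w)%:E)%E.
  rewrite -EFinM indicE; congr (_ * _%:R)%:E; congr nat_of_bool.
  by apply/eqP/idP => [/mem_set//|/set_mem].
have mind a :
  measurable_fun setT
    (fun w => (\1_([set w | xi X a w = r]) w)%:E : \bar R).
  by apply/measurable_EFinP; apply: measurable_indic; exact: measurable_xi_eq.
under eq_integral do rewrite /occupancy_mass fineK//.
rewrite integral_esum//; last first.
  move=> a; under eq_fun do rewrite ind.
  exact: measurable_funeM.
apply: eq_esum => a _; under eq_integral do rewrite ind.
rewrite ge0_integralZl_EFin//.
rewrite integral_indic ?setIT//; last exact: measurable_xi_eq.
transitivity ((p a)%:E * Pr [set w | xi X a w = r])%E; first by [].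
rewrite Pr_xi_eq -EFinM /binom_mass exprS; congr EFin; ring.
Qed.

End occupancy.

Theorem theorem2p3 (R : realType) (dO dA : measure_display)
    (Omega : measurableType dO) (Pr : probability Omega R)
    (A : measurableType dA) (p : A -> R) (n r : nat)
    (X : 'I_n -> {RV Pr >-> A}) :
  countable [set: A] ->
  (forall a : A, measurable [set a]) ->
  is_distribution p ->
  iid_sample p X ->
  (1 <= n)%N ->
  (r <= n - 1)%N ->
  (ereal_sup [set (phi_minus p n r eps + theta_minus p n r eps)%E
             | eps in `]0%R, (1 / 2)%R]] <=
   'E_Pr[occupancy_mass p X r])%E.
Proof.
move=> cA mA pP iidX _ _; rewrite expectation_occupancy_mass//.
apply: ge_ereal_sup => _ [eps /=] /[!in_itv]/= eps12 <-.
rewrite (esumID [set a | eps <= p a]); last first.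
  by move=> a _; rewrite lee_fin binom_mass_ge0// distr_ge0// distr_le1.
rewrite !setTI (_ : ~` _ = [set a | p a < eps]); last first.
  by apply/seteqP; split => a /=; rewrite ltNge => /negP.
apply: leeD; last exact: theta_minus_le.
by apply: phi_minus_le => //; case/andP: eps12.
Qed.
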